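(* Let $d\geq 1$, $r\geq d+1$, $1\leq m\leq r$ and $m\leq k\leq \min\{m+d,r\}$ be integers. Let $P$ be a finite family of points in $\mathbb{R}^d$ colored with $r$ colors, with $|P|\geq \max\{m+d,r\}$. Assume that for every choice of $r-k+1$ color classes, the convex hull of their union contains the origin. Then there is some $\{u_1,\ldots,u_d,v_1,\ldots,v_m\}\subset P$ (of $d+m$ distinct members), colored with at least $k$ different colors, such that $0\in \operatorname{conv}(\{u_1,\ldots,u_d,v_i\})$ for all $i\in\{1,\ldots,m\}$.
   Context: A family colored with $r$ colors is partitioned into $r$ color classes. $\operatorname{conv}$ denotes the convex hull. *)

(* Defs.v *)
From mathcomp Require Import all_boot all_order all_algebra.
From mathcomp Require Import all_classical all_reals all_analysis.

Set Implicit Arguments.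
Unset Strict Implicit.
Unset Printing Implicit Defensive.

Import Order.TTheory GRing.Theory Num.Theory.

Local Open Scope classical_set_scope.
Local Open Scope ring_scope.

(* The intersection of all convex sets containing A. *)
Definition convex_hull (R : numDomainType) (E : lmodType R) (A : set E) : set E :=
  smallest (@convex_set R (convex_lmodType E)) A.

(* A family colored with r colors is an index type I with a coloring
   c : I -> 'I_r; classes consist of indices, so that members of the family at
   the same point of space stay distinct. A class may be empty. *)
Definition color_class (I : Type) (r : nat) (c : I -> 'I_r) (a : 'I_r) : set I :=
  [set i | c i = a].

(* Main.v *)
(* Among the d-element subsets S of the family with at least k - m colors, take
   one whose convex hull is closest to the origin, and let z be its point nearest
   to 0. If z = 0, any further points can serve as the v_i. Otherwise the closed
   halfspace [<z, w> <= 0] misses S, and it contains points of at least k colors,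
   because any r - k + 1 classes have 0 in their convex hull. For w in it,
   conv (S + w) contains a point closer to 0 than z; if it does not contain 0
   itself, this point can be pushed towards 0 until it lies in the hull of d of
   the d + 1 points, contradicting the choice of S unless those d points have
   fewer than k - m colors. That exception needs S to have exactly k - m colors
   and the color of w to occur in S, so there remain at least m admissible points,
   and together with S they carry at least k colors. *)
Require Import Defs.
From mathcomp Require Import all_boot all_order all_algebra.
From mathcomp Require Import all_classical all_reals all_analysis.
From mathcomp Require Import ring lra zify.

Set Implicit Arguments.
Unset Strict Implicit.
Unset Printing Implicit Defensive.

Import Order.TTheory GRing.Theory Num.Theory.
Import numFieldNormedType.Exports.

Local Open Scope classical_set_scope.
Local Open Scope ring_scope.

(** * Inner product, and linear dependence among more than [d] vectors *)

Section InnerProduct.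
Variables (R : realFieldType) (d : nat).
Implicit Types u v w : 'rV[R]_d.

Definition dot u v : R := \sum_j u 0 j * v 0 j.

Lemma dotC u v : dot u v = dot v u.
Proof. by apply: eq_bigr => j _; rewrite mulrC. Qed.

Lemma dotDr u v w : dot u (v + w) = dot u v + dot u w.
Proof. by rewrite -big_split; apply: eq_bigr => j _; rewrite mxE mulrDr. Qed.

Lemma dotZr a u v : dot u (a *: v) = a * dot u v.
Proof. by rewrite mulr_sumr; apply: eq_bigr => j _; rewrite mxE mulrCA. Qed.

Lemma dotDl u v w : dot (u + v) w = dot u w + dot v w.
Proof. by rewrite dotC dotDr !(dotC w). Qed.

Lemma dotZl a u v : dot (a *: u) v = a * dot u v.
Proof. by rewrite dotC dotZr dotC. Qed.

Lemma dot0r u : dot u 0 = 0.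
Proof. by rewrite -(scale0r 0) dotZr mul0r. Qed.

Lemma dot_ge0 u : 0 <= dot u u.
Proof. by apply: sumr_ge0 => j _; rewrite -expr2 sqr_ge0. Qed.

Lemma dot_eq0 u : dot u u = 0 -> u = 0.
Proof.
move=> /psumr_eq0P u0; apply/rowP => j; rewrite mxE; apply/eqP.
by rewrite -[_ == _]orbb -mulf_eq0 u0// => i _; rewrite -expr2 sqr_ge0.
Qed.

(** The cross term is nonpositive; [t = a / (a + b)] minimizes what remains, [t^2 b + (1 - t)^2 a],
    with value [a b / (a + b) < a]. *)
Lemma segment_closer z w : z != 0 -> dot z w <= 0 ->
  exists2 t : R, 0 <= t <= 1
    & dot (t *: w + (1 - t) *: z) (t *: w + (1 - t) *: z) < dot z z.
Proof.
move=> z0 zw; set a := dot z z; set b := dot w w.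
have a0 : 0 < a.
  by rewrite lt_neqAle dot_ge0 andbT eq_sym; apply: contra z0 => /eqP/dot_eq0 ->.
have b0 : 0 <= b by exact: dot_ge0.
have ab : 0 < a + b by lra.
pose t := a / (a + b).
have t0 : 0 < t by rewrite divr_gt0.
have t1 : t <= 1 by rewrite ler_pdivrMr// mul1r; lra.
have tab : t * (a + b) = a by rewrite divfK// gt_eqF.
exists t; first by rewrite t1 ltW.
rewrite dotDl !dotDr !dotZl !dotZr -/a -/b (dotC w z).
have : (1 - t) * (t * dot z w) <= 0.
  by rewrite mulr_ge0_le0 ?mulr_ge0_le0//; lra.
have : 0 < t * a by rewrite mulr_gt0.
have : t * (t * (a + b)) = t * a by rewrite tab.
nra.
Qed.

(** A matrix with more rows than columns has a nonzero vector in its left kernel, here extended by 0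
    outside [T]. *)
Lemma dependent_family (I : finType) (P : I -> 'rV[R]_d) (T : {set I}) :
  (d < #|T|)%N -> exists a : I -> R,
    [/\ forall i, i \notin T -> a i = 0, exists i, a i != 0
      & \sum_i a i *: P i = 0].
Proof.
move=> dT; pose M : 'M[R]_(#|T|, d) := \matrix_i P (enum_val i).
have : kermx M != 0.
  rewrite -mxrank_eq0 mxrank_ker subn_eq0 -ltnNge.
  exact: leq_ltn_trans (rank_leq_col M) dT.
case/rowV0Pn => v /sub_kermxP vM v0.
pose a i := \sum_(k < #|T| | enum_val k == i) v 0 k.
have aE (k : 'I_#|T|) : a (enum_val k) = v 0 k.
  by rewrite /a (big_pred1 k)// => j; rewrite /= (inj_eq enum_val_inj).
have aT i : i \notin T -> a i = 0.
  by move=> iT; apply: big_pred0 => k; apply: contraNF iT => /eqP <-; exact: enum_valP.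
exists a; split.
- exact: aT.
- by have /rV0Pn[k vk] := v0; exists (enum_val k); rewrite aE.
- rewrite (bigID (mem T))/= [X in _ + X]big1 ?addr0; last first.
    by move=> i iT; rewrite aT// scale0r.
  rewrite big_enum_val/= -[RHS]vM mulmx_sum_row.
  by apply: eq_bigr => k _; rewrite aE rowK.
Qed.

End InnerProduct.

(** * Convex combinations as weight functions *)

Section Weights.
Variables (R : realType) (d : nat) (I : finType) (P : I -> 'rV[R]_d).
Implicit Types (S T : {set I}) (x y : I -> R).

Definition comb x : 'rV[R]_d := \sum_i x i *: P i.

(** Weights live on all of [I], so that exchanging points of [S] does not change their type. *)
Definition weights S x :=
  [/\ forall i, 0 <= x i, forall i, i \notin S -> x i = 0 & \sum_i x i = 1].

Lemma weightsS S T x : S \subset T -> weights S x -> weights T x.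
Proof.
move=> /fintype.subsetP ST [x0 xS x1]; split=> // i iT; apply: xS.
by apply: contra iT; exact: ST.
Qed.

Lemma weights1 S i : i \in S -> weights S (fun j => (j == i)%:R).
Proof.
move=> iS; split=> [j|j jS|]; first by rewrite ler0n.
- by case: eqP jS => [->|//]; rewrite iS.
- rewrite (bigD1 i)//= eqxx big1 ?addr0// => j /negbTE -> //.
Qed.

Lemma comb1 i : comb (fun j => (j == i)%:R) = P i.
Proof.
rewrite /comb (bigD1 i)//= eqxx scale1r big1 ?addr0// => j /negbTE ->.
by rewrite scale0r.
Qed.

Lemma weights_conv S x y t : 0 <= t <= 1 -> weights S x -> weights S y ->
  weights S (fun i => t * x i + (1 - t) * y i).
Proof.
move=> /andP[t0 t1] [x0 xS x1] [y0 yS y1]; split=> [i|i iS|].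
- by rewrite addr_ge0// mulr_ge0// subr_ge0.
- by rewrite xS// yS// !mulr0 addr0.
- by rewrite big_split/= -!mulr_sumr x1 y1; ring.
Qed.

Lemma combD (a b : R) x y :
  comb (fun i => a * x i + b * y i) = a *: comb x + b *: comb y.
Proof.
rewrite /comb !scaler_sumr -big_split; apply: eq_bigr => i _ /=.
by rewrite scalerDl !scalerA.
Qed.

Lemma weights_normalize S x : (forall i, 0 <= x i) ->
  (forall i, i \notin S -> x i = 0) -> 0 < \sum_i x i ->
  weights S (fun i => (\sum_i x i)^-1 * x i).
Proof.
move=> x0 xS s0; split=> [i|i iS|]; first by rewrite mulr_ge0// invr_ge0 ltW.
- by rewrite xS// mulr0.
- by rewrite -mulr_sumr mulVf// gt_eqF.
Qed.

Lemma combZ (a : R) x : comb (fun i => a * x i) = a *: comb x.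
Proof.
by rewrite /comb scaler_sumr; apply: eq_bigr => i _; rewrite scalerA.
Qed.

(* A linear dependence [a] with [\sum a >= 0] has a negative entry unless it
   exhibits 0 as a convex combination. Adding a positive multiple of [a] to [y]
   keeps [comb y] and does not decrease the total mass, so renormalizing only
   moves the point towards 0; stop when a weight vanishes. *)
Lemma weights_exchange T y : (d < #|T|)%N -> weights T y ->
  (exists2 x, weights T x & comb x = 0) \/
  exists i, exists2 x, weights (T :\ i) x /\ i \in T
                     & dot (comb x) (comb x) <= dot (comb y) (comb y).
Proof.
move=> dT [y0 yT y1].
have [a [aT [i0 ai0] Pa sa]] : exists a : I -> R,
    [/\ forall i, i \notin T -> a i = 0, exists i, a i != 0,
        comb a = 0 & 0 <= \sum_i a i].
  have [a [aT [i ai] Pa]] := dependent_family P dT.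
  have [sa|/ltW sa] := leP 0 (\sum_i a i); first by exists a; split=> //; exists i.
  exists (fun i => -1 * a i); split.
  - by move=> j jT; rewrite aT// mulr0.
  - by exists i; rewrite mulN1r oppr_eq0.
  - by rewrite combZ [comb a]Pa scaler0.
  - by rewrite -mulr_sumr mulN1r oppr_ge0.
have [/forallP a0|] := boolP [forall i, 0 <= a i].
  left; have s0 : 0 < \sum_i a i.
    rewrite lt_neqAle sa andbT eq_sym; apply: contra ai0 => /eqP.
    by move=> /psumr_eq0P -> //.
  exists (fun i => (\sum_i a i)^-1 * a i); first exact: weights_normalize.
  by rewrite combZ Pa scaler0.
rewrite negb_forall => /existsP[i1]; rewrite -ltNge => ai1; right.
(* Ratio test: the least [y i / - a i] is the largest [t] that keeps all [y j + t * a j]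
   nonnegative. *)
pose i := [arg min_(i < i1 | a i < 0) (y i / - a i)%R]%O.
have [ai imin] : a i < 0 /\ forall j, a j < 0 -> y i / - a i <= y j / - a j.
  by rewrite /i; case: arg_minP => // j aj jmin; split.
pose t := y i / - a i.
have t0 : 0 <= t by rewrite divr_ge0// oppr_ge0 ltW.
pose x j := 1 * y j + t * a j.
have x0 j : 0 <= x j.
  rewrite /x mul1r; have [aj|aj] := leP 0 (a j).
    by rewrite addr_ge0// mulr_ge0.
  by have := imin _ aj; rewrite ler_pdivlMr ?oppr_gt0// -/t; lra.
have xi : x i = 0.
  have : t * - a i = y i by rewrite divfK// oppr_eq0 lt_eqF.
  by rewrite /x; lra.
have xT j : j \notin T :\ i -> x j = 0.
  rewrite !inE negb_and negbK => /orP[/eqP ->//|jT].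
  by rewrite /x yT// aT// !mulr0 addr0.
have xs : 1 <= \sum_i x i.
  by rewrite big_split/= -!mulr_sumr y1 mulr1 lerDl mulr_ge0.
exists i, (fun j => (\sum_i x i)^-1 * x j).
  split; first by apply: weights_normalize => //; lra.
  by apply: contraTT ai => iT; rewrite aT// ltxx.
rewrite combZ dotZl dotZr [comb x]combD Pa scaler0 addr0 scale1r.
rewrite mulrA ler_piMl ?dot_ge0// -invfM invf_le1.
  by rewrite mulr_ege1.
by rewrite mulr_gt0//; lra.
Qed.

(** The weights form a compact set: a product of segments, degenerate outside [S], cut by the closed
    condition of total mass 1. The squared norm attains its minimum there. *)
Lemma nearest_weights S : (0 < #|S|)%N -> exists2 x, weights S x &
  forall y, weights S y -> dot (comb x) (comb x) <= dot (comb y) (comb y).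
Proof.
case/card_gt0P => i0 i0S.
pose A i : set R := [set` if i \in S then `[0, 1] else `[0, 0]].
pose W := prod_topology (fun _ : I => R).
pose B : set W := [set x | forall i, A i (x i)].
pose C : set W := [set x | \sum_i x i = 1].
have cproj i : continuous (fun x : W => x i : R).
  exact: (@proj_continuous _ (fun _ : I => R) i).
have csum (F : I -> W -> R) :
    (forall i, continuous (F i)) -> continuous (fun x : W => \sum_i F i x).
  by move=> cF; apply: continuous_big => //; exact: add_continuous.
have BC : B `&` C = [set x | weights S x].
  apply/seteqP; split=> x /=.
    move=> [Bx Cx]; split=> // i; have := Bx i; rewrite /A.
      by case: ifP => _ /=; rewrite in_itv/= => /andP[].
    by move=> + /negbTE iS; rewrite iS/= in_itv/= -eq_le => /eqP.
  move=> [x0 xS x1]; split=> // i; rewrite /A; case: ifPn => [iS|/xS ->].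
    by rewrite /= in_itv/= x0 -x1 (bigD1 i)//= lerDl sumr_ge0.
  by rewrite /= in_itv/= lexx.
have cBC : compact (B `&` C).
  apply: compact_closedI.
    by apply: tychonoff => i; rewrite /A; case: ifP => _; exact: segment_compact.
  apply: (@preimage_closed _ _ (fun x : W => \sum_i x i) [set 1]) => [x _|].
    exact: csum.
  exact: closed_eq.
have [||x] := @compact_EVT_min _ R (fun x : W => dot (comb x) (comb x)) _ _ cBC.
- by exists (fun j => (j == i0)%:R); rewrite BC; exact: weights1.
- apply: continuous_subspaceT; rewrite /dot.
  apply: continuous_big => //; first exact: add_continuous.
  move=> j _; have cj : continuous (fun x : W => comb x 0 j).
    have -> : (fun x : W => comb x 0 j) = fun x => \sum_i x i * P i 0 j.
      by apply/funext => z; rewrite /comb summxE; apply: eq_bigr => i _; rewrite mxE.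
    by apply: csum => i z; apply: continuousM; [exact: cproj|exact: cst_continuous].
  by move=> x; apply: continuousM; exact: cj.
rewrite BC inE => Sx xmin; exists x => // y Sy.
by apply: xmin; rewrite inE.
Qed.

(** Convexity is given for two points only, so an induction over a list of indices treats partial
    sums rescaled to mass 1. *)
Lemma convex_hull_comb S x (A : set 'rV[R]_d) : weights S x ->
  (forall i, i \in S -> A (P i)) -> convex_hull A (comb x).
Proof.
move=> [x0 xS x1] SA C [Cconv AC].
suff H (s : seq I) : 0 < \sum_(i <- s) x i ->
    C ((\sum_(i <- s) x i)^-1 *: \sum_(i <- s) x i *: P i).
  by have := H (index_enum I); rewrite x1 invr1 scale1r; exact.
elim: s => [|i s IH]; first by rewrite big_nil ltxx.
rewrite !big_cons; set a := \sum_(j <- s) x j in IH *.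
have a0 : 0 <= a by exact: sumr_ge0.
have [-> |xi] := eqVneq (x i) 0; first by rewrite scale0r !add0r.
move=> _; have CPi : C (P i).
  by apply/AC/SA; apply: contraR xi => /xS ->.
have {}xi : 0 < x i by rewrite lt_neqAle eq_sym xi x0.
have [sa|an0] := eqVneq a 0.
  rewrite sa addr0 [X in _ + X]big1_seq; last first.
    move=> j /andP[_ js]; move/eqP: sa; rewrite psumr_eq0// => /allP/(_ _ js)/eqP ->.
    by rewrite scale0r.
  by rewrite addr0 scalerA mulVf ?gt_eqF// scale1r.
have {}a0 : 0 < a by rewrite lt_neqAle eq_sym an0 a0.
pose t := x i / (x i + a).
have s0 : 0 < x i + a by rewrite addr_gt0.
have t0 : 0 <= t by rewrite divr_ge0// ltW.
have t1 : t <= 1 by rewrite ler_pdivrMr// mul1r lerDl ltW.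
have := Cconv (P i) (a^-1 *: \sum_(j <- s) x j *: P j) (Itv01 t0 t1).
rewrite !inE => /(_ CPi (IH a0)); congr C.
rewrite /conv/= scalerDr !scalerA; congr (_ *: _ + _ *: _).
  by rewrite /t mulrC.
rewrite /unstable.onem /t; field.
by rewrite !gt_eqF.
Qed.

End Weights.

(** Otherwise the open halfspace [0 < dot z w] would be a convex set containing [A], hence
    containing 0. *)
Lemma convex_hull0_dot (R : realType) (d : nat) (A : set 'rV[R]_d) z :
  convex_hull A 0 -> exists2 w, A w & dot z w <= 0.
Proof.
move=> A0; apply: contrapT => nA.
suff : dot z 0 > 0 by rewrite dot0r ltxx.
apply: (A0 [set w | 0 < dot z w]); split.
  apply/convex_setW => x y; rewrite !inE/= => zx zy k k0 k1.
  rewrite inE/= /conv/= dotDr !dotZr addr_gt0// mulr_gt0//.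
  by rewrite /unstable.onem subr_gt0.
move=> w Aw /=; rewrite ltNge; apply/negP => zw.
by apply: nA; exists w.
Qed.

(* Restores the finite-set names shadowed by their classical_sets homonyms. *)
From mathcomp Require Import boot.fintype boot.finset.

(** * Counting colors *)

Section Colors.
Variables (I C : finType) (c : I -> C).
Implicit Types U V W : {set I}.

Lemma card_imset_setD1 U i : (#|c @: U| <= #|c @: (U :\ i)|.+1)%N.
Proof.
have [iU|iU] := boolP (i \in U); last first.
  rewrite (_ : U :\ i = U) ?leqnSn//; apply/setP => j; rewrite !inE.
  by case: eqP => [->|]//; rewrite (negbTE iU).
by rewrite -{1}(setD1K iU) imsetU1 cardsU1 -add1n leq_add2r leq_b1.
Qed.

(** Greedy choice: each new point of [W] brings a new color, until [U :|: V] has all colors of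
    [U :|: W], at least [k]; from then on any point will do. *)
Lemma colorful_extension U W k m : (m <= #|W|)%N -> (k <= #|c @: (U :|: W)|)%N ->
  exists V, [/\ V \subset W, #|V| = m & (minn k (#|c @: U| + m) <= #|c @: (U :|: V)|)%N].
Proof.
move=> + kW; elim: m => [_|m IH mW].
  by exists set0; rewrite sub0set cards0 setU0 addn0 geq_minr.
have [V [VW Vm kV]] := IH (ltnW mW).
have [/subsetP WV|/subsetPn[_ /imsetP[w wW ->] cw]] :=
    boolP (c @: W \subset c @: (U :|: V)).
  have : (0 < #|W :\: V|)%N by rewrite cardsD (setIidPr VW) Vm subn_gt0.
  case/card_gt0P => w; rewrite inE => /andP[wV wW].
  exists (w |: V); split; rewrite ?subUset ?sub1set ?wW ?cardsU1 ?wV ?Vm//.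
  apply: leq_trans (geq_minl _ _) (leq_trans kW _); apply: subset_leq_card.
  apply/subsetP => _ /imsetP[i + ->]; rewrite inE => /orP[iU|iW].
    by rewrite imset_f// inE iU.
  have := WV _ (imset_f c iW); apply: subsetP.
  by rewrite imsetS// setUS// subsetUr.
have wV : w \notin V by apply: contra cw => wV; rewrite imset_f// inE wV orbT.
exists (w |: V); split; rewrite ?subUset ?sub1set ?wW ?cardsU1 ?wV ?Vm//.
rewrite setUCA imsetU1 cardsU1 cw add1n addnS.
rewrite (leq_trans _ (_ : (minn k (#|c @: U| + m)).+1 <= _)%N)//; lia.
Qed.

End Colors.

(** * The extremal set and the selection of the points *)

Lemma enum_card (I : finType) (S : {set I}) n : #|S| = n ->
  exists2 f : 'I_n -> I, injective f & codom f =i S.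
Proof.
move=> <-; exists enum_val; first exact: enum_val_inj.
move=> i; apply/codomP/idP => [[k ->]|iS]; first exact: enum_valP.
by exists (enum_rank_in iS i); rewrite enum_rankK_in.
Qed.

(** With fewer than [k] colors in the halfspace, some [r - k + 1] classes would miss it, although 0
    lies in the hull of their union. *)
Lemma halfspace_colors (R : realType) (d r k : nat) (I : finType)
    (P : I -> 'rV[R]_d) (c : I -> 'I_r) z : (k <= r)%N ->
  (forall J : {set 'I_r}, #|J| = (r - k + 1)%N ->
    convex_hull (\bigcup_(a in [set` J]) (P @` color_class c a)) 0) ->
  (k <= #|c @: [set i | (dot z (P i) <= 0)%R]%SET|)%N.
Proof.
move=> kr hJ; set W := [set i | _]%SET; rewrite leqNgt; apply/negP => Wk.
have : (r - k + 1 <= #|~: (c @: W)|)%N by rewrite cardsCs setCK card_ord; lia.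
case/card_geqP => s [us ss sW].
have [|_ [a /= aJ [i ci <-]] zi] := @convex_hull0_dot _ _ _ z (hJ [set x in s]%SET _).
  by rewrite cardsE (card_uniqP us).
have := sW a; rewrite inE in aJ; move/(_ aJ).
by rewrite inE -ci imset_f// inE.
Qed.

Theorem theorem6p1 (R : realType) (d r m k : nat) (I : finType)
    (P : I -> 'rV[R]_d) (c : I -> 'I_r) :
  (1 <= d)%N -> (d + 1 <= r)%N -> (1 <= m <= r)%N ->
  (m <= k <= minn (m + d) r)%N ->
  (maxn (m + d) r <= #|I|)%N ->
  (forall J : {set 'I_r}, #|J| = (r - k + 1)%N ->
    convex_hull (\bigcup_(a in [set` J]) (P @` color_class c a)) 0) ->
  exists (u : 'I_d -> I) (v : 'I_m -> I),
    [/\ injective u, injective v, (forall i j, u i <> v j),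
        (k <= #|c @: (codom u ++ codom v)|)%N
      & forall i : 'I_m, convex_hull (range (P \o u) `|` [set P (v i)]) 0].
Proof.
move=> d1 _ _; rewrite leq_min geq_max => /andP[mk /andP[kmd kr]] /andP[mdI _] hJ.
have hW z := halfspace_colors z kr hJ.
have kT : (k <= #|c @: [set: I]%SET|)%N.
  by apply: leq_trans (hW 0) _; rewrite subset_leq_card// imsetS// subsetT.
have /choice[X hX] : forall S : {set I}, exists x : I -> R, (0 < #|S|)%N ->
    weights S x /\ forall y, weights S y ->
      dot (comb P x) (comb P x) <= dot (comb P y) (comb P y).
  move=> S; have [S0|S0] := leqP #|S| 0; first by exists (fun=> 0).
  by have [x Sx xmin] := nearest_weights P S0; exists x.
pose f S := dot (comb P (X S)) (comb P (X S)).
pose adm (S : {set I}) := (#|S| == d) && (k - m <= #|c @: S|)%N.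
have [S1 admS1] : exists S, adm S.
  (* Extending the empty set by [d] points yields [minn (k - m) d] colors, which is [k - m] because
     [k <= m + d]. *)
  have [||S [_ Sd Sk]] := @colorful_extension _ _ c set0 [set: I]%SET (k - m) d.
  - by rewrite cardsT; lia.
  - by rewrite set0U; lia.
  - by exists S; rewrite /adm Sd eqxx; move: Sk; rewrite imset0 cards0 set0U; lia.
have [S /andP[/eqP Sd Sk] Smin] := arg_minP f admS1.
have [] := hX S; first by rewrite Sd.
set x := X S => Sx xmin; set z := comb P x in xmin.
pose good w := exists2 y, weights (w |: S) y & comb P y = 0.
pose G := [set w | (w \notin S) && `[< good w >]]%SET.
(* These two bounds suffice: a greedy extension of [S] by [m] points of [G] reaches [k] colors, as
   [S] already has [k - m]. *)
have [GS Gm] : (k <= #|c @: (S :|: G)|)%N /\ (m <= #|G|)%N.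
  have [z0|z0] := eqVneq z 0.
    have -> : G = ~: S.
      apply/setP => w; rewrite !inE andb_idr// => _; apply/asboolP.
      by exists x => //; apply: weightsS Sx; rewrite subsetUr.
    by rewrite setUCr; split=> //; rewrite cardsCs setCK Sd; lia.
  set W := [set i | (dot z (P i) <= 0)%R]%SET in hW.
  have closer w : w \in W -> exists2 y, weights (w |: S) y &
      dot (comb P y) (comb P y) < dot z z.
    rewrite inE => zw; have [t t01 tlt] := segment_closer z0 zw.
    exists (fun i => t * (i == w)%:R + (1 - t) * x i).
      apply: weights_conv => //; first by apply: weights1; rewrite setU11.
      by apply: weightsS Sx; rewrite subsetUr.
    by rewrite combD comb1.
  have WS w : w \in W -> w \notin S.
    move=> /closer[y wy yz]; apply/negP => wS.
    suff /xmin : weights S y by rewrite leNgt yz.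
    by move: wy; rewrite (setUidPr _)// sub1set.
  (* The exchange drops some [i]. If [i = w], the new point contradicts the choice of [z]; otherwise
     at most one color is lost, and either [w] brings a new one or [S] had one to spare, so
     minimality of [S] is contradicted. *)
  have WG w : w \in W -> (c w \notin c @: S) || (k - m < #|c @: S|)%N -> w \in G.
    move=> wW cw; have wS := WS _ wW; rewrite inE wS; apply/asboolP.
    have [y wy yz] := closer _ wW.
    have [|//|[i [x' [Tx' iT] x'y]]] := weights_exchange P _ wy.
      by rewrite cardsU1 wS Sd.
    have {x'y yz} x'z := le_lt_trans x'y yz.
    have [iw|iw] := eqVneq i w.
      suff /xmin : weights S x' by rewrite leNgt x'z.
      by move: Tx'; rewrite iw setU1K.
    have Td : #|(w |: S) :\ i| = d.
      by have := cardsD1 i (w |: S); rewrite iT cardsU1 wS Sd => -[].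
    have : adm ((w |: S) :\ i).
      rewrite /adm Td eqxx/=.
      have -> : (w |: S) :\ i = w |: (S :\ i).
        by apply/setP => j; rewrite !inE; case: (eqVneq j w) => // ->; rewrite eq_sym iw.
      have := card_imset_setD1 c S i; rewrite imsetU1 cardsU1.
      case/orP: cw => [cw|]; last by lia.
      have -> : c w \notin c @: (S :\ i).
        by apply: contra cw; apply/subsetP/imsetS/subD1set.
      lia.
    move=> /Smin; rewrite leNgt => /negP[]; apply: le_lt_trans x'z.
    by have [] := hX ((w |: S) :\ i); [rewrite Td|move=> _; apply].
  split.
    apply: leq_trans (hW z) _; apply/subset_leq_card/subsetP => _ /imsetP[w wW ->].
    have [cw|cw] := boolP (c w \in c @: S).
      by move: cw; apply/subsetP; rewrite imsetS// subsetUl.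
    by rewrite imset_f// inE WG ?orbT// cw.
  (* With a spare color, all of [W] lies in [G]. Otherwise [S] has at most [k - m] colors, so at
     least [m] of the colors of [W] are absent from [S], and each gives a point of [G]. *)
  have [kS|kS] := ltnP (k - m) #|c @: S|.
    apply: leq_trans mk (leq_trans (hW z) (leq_trans (leq_imset_card _ _) _)).
    by apply/subset_leq_card/subsetP => w wW; rewrite WG// kS orbT.
  have : (#|c @: W :\: c @: S| <= #|G|)%N.
    apply: leq_trans (leq_imset_card c _); apply/subset_leq_card/subsetP.
    move=> _ /setDP[/imsetP[w wW ->] cw].
    by rewrite imset_f// WG// cw.
  have := hW z; rewrite -(cardsID (c @: S) (c @: W)).
  have := subset_leq_card (subsetIr (c @: W) (c @: S)); lia.
have [V [VG Vm kV]] := colorful_extension Gm GS.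
have [u u_inj uS] := enum_card Sd; have [v v_inj vV] := enum_card Vm.
have Su i : u i \in S by rewrite -uS codom_f.
have Gv i : v i \in G by apply: (subsetP VG); rewrite -vV codom_f.
exists u, v; split=> //.
- by move=> i j uv; have := Gv j; rewrite inE -uv Su.
- have -> : c @: (codom u ++ codom v) = c @: (S :|: V).
    by apply/setP => a; apply/imsetP/imsetP => -[i iuv ->]; exists i => //;
       move: iuv; rewrite mem_cat inE uS vV.
  by apply: leq_trans kV; lia.
- move=> i; have := Gv i; rewrite inE => /andP[_ /asboolP[y vy <-]].
  apply: convex_hull_comb vy _ => j; rewrite !inE => /orP[/eqP ->|]; first by right.
  by rewrite -uS => /codomP[l ->]; left; exists l.
Qed.
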